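(* Let $M$ be an open oriented 3-manifold, homeomorphic to the interior of a compact 3-manifold $\overline M$ with nonempty boundary, and equipped with an ideal triangulation. Then for any abstract oscillating curves $\zeta,\zeta'$ in $M$, $$\omega(h(\zeta),h(\zeta'))=2\,\zeta\cdot\zeta',$$ where $\omega$ is the Neumann–Zagier symplectic form, $h$ is the combinatorial holonomy and $\zeta\cdot\zeta'$ is the intersection number.
   Context: **Triangulation and labels.** $M$ is obtained from oriented ideal tetrahedra $t_1,\dots,t_n$ (vertices removed) by gluing all faces in pairs by orientation-reversing maps, and truncating the ideal vertices decomposes $\overline M$ into truncated tetrahedra; the boundary components may have any genus. Label the edges of each $t_i$ by $a,b,c$ so that opposite edges have the same label and the three edges at each vertex are labelled $a,b,c$ in anticlockwise order viewed from outside. The truncated $t_i$ has four triangular faces $\Delta$ (one per ideal vertex) and four hexagonal faces $F$ (one per face of $t_i$). Corners of $\Delta$ are labelled $a,b,c$ by the edge of $t_i$ ending there; the side of $\Delta$ between corners $a,b$ is labelled $ab$, similarly $bc,ca$. A hexagon $F$ has three short sides (sides of triangles), which carry labels $ab,bc,ca$ (in clockwise order viewed from outside), alternating with three long sides (along edges of $t_i$). If $F$ is glued to $\widehat F$, the short side of $F$ labelled $k$ is glued to a short side of $\widehat F$ whose label is denoted $\widehat k$; because gluings reverse orientation, if $(k,l,m)$ is a cyclic permutation of $(ab,bc,ca)$ then $(\widehat k,\widehat l,\widehat m)$ is a cyclic permutation of $(ab,ca,bc)$. **Abstract oscillating curves.** There is an oriented enhanced train track on the Heegaard surface bounding the handlebody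 obtained from $\overline M$ by removing open tubular neighbourhoods of the ideal edges. Its oriented branches are: for each triangle $\Delta$, the branches $\gamma_{\Delta(a)},\gamma_{\Delta(b)},\gamma_{\Delta(c)}$ (running around the corners of $\Delta$) and $\gamma_{\Delta(ab)},\gamma_{\Delta(bc)},\gamma_{\Delta(ca)}$ (running out across the sides of $\Delta$); for each hexagon $F$ and distinct $k,l\in\{ab,bc,ca\}$, the branches $\gamma_{F(k)}$ (running to the short side $k$) and $\gamma_{F(k,l)}$ (starting near the short side $k$ and running along the long side towards the short side $l$). An abstract oscillating curve $\zeta=\sum_\gamma n_\gamma\gamma$ is an assignment of an integer $n_\gamma$ to each branch satisfying the following, where $n_\bullet$ abbreviates $n_{\gamma_\bullet}$: (1) for each triangle $\Delta$: $n_{\Delta(ab)}=n_{\Delta(a)}-n_{\Delta(b)}$, $n_{\Delta(bc)}=n_{\Delta(b)}-n_{\Delta(c)}$, $n_{\Delta(ca)}=n_{\Delta(c)}-n_{\Delta(a)}$; (2) whenever the side $k$ of $\Delta$ is the short side $k$ of $F$, and $\{k,l,m\}=\{ab,bc,ca\}$: $n_{\Delta(k)}=n_{F(k)}+n_{F(k,l)}+n_{F(k,m)}$; (3) for glued short sides $k,\widehat k$ of glued hexagons $F,\widehat F$: $n_{F(k)}+n_{\widehat F(\widehat k)}=0$; (4) for glued hexagons $F,\widehat F$ and $k\ne l$: $n_{F(k,l)}+n_{\widehat F(\widehat k,\widehat l)}=n_{F(l,k)}+n_{\widehat F(\widehat l,\widehat k)}$. **Intersection number.** Put $\epsilon_{k,l}=1$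 if $(k,l)\in\{(a,b),(b,c),(c,a),(ab,bc),(bc,ca),(ca,ab)\}$, $\epsilon_{k,l}=-1$ if $(l,k)$ is in this set, and $0$ otherwise. Define an antisymmetric bilinear pairing on branches by $\gamma_{\Delta(x)}\cdot\gamma_{\Delta(y)}=\epsilon_{x,y}$ for $x,y\in\{a,b,c\}$; $\gamma_{F(k)}\cdot\gamma_{F(k,l)}=\epsilon_{k,l}$; $\gamma_{F(k,l)}\cdot\gamma_{F(k,m)}=-\epsilon_{l,m}$; $\gamma_{F(k,l)}\cdot\gamma_{F(l,k)}=\epsilon_{k,l}$; all other pairings of branches (not obtained from these by antisymmetry) being $0$. For $\zeta=\sum n_\gamma\gamma$, $\zeta'=\sum n'_\gamma\gamma$, the intersection number $\zeta\cdot\zeta'$ is defined by $2\zeta\cdot\zeta'=(\sum n_\gamma\gamma)\cdot(\sum n'_\gamma\gamma)$. **Symplectic space and holonomy.** $\mathcal V$ is the $2n$-dimensional real vector space generated by $\mathbf a_i,\mathbf b_i,\mathbf c_i$ ($1\le i\le n$) subject to $\mathbf a_i+\mathbf b_i+\mathbf c_i=0$, with the symplectic form $\omega(\mathbf a_i,\mathbf b_j)=\omega(\mathbf b_i,\mathbf c_j)=\omega(\mathbf c_i,\mathbf a_j)=\delta_{ij}$. The combinatorial holonomy is $h(\zeta)=\sum n_\gamma h(\gamma)\in\mathcal V$, where $h(\gamma_{\Delta(a)})=\mathbf a_i$, $h(\gamma_{\Delta(b)})=\mathbf b_i$, $h(\gamma_{\Delta(c)})=\mathbf c_i$ if $\Delta$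 is a triangular face of the truncated $t_i$, and $h(\gamma)=0$ for all other branches. *)

(* Defs.v *)
From HB Require Import structures.
From mathcomp Require Import all_boot all_order all_algebra all_fingroup.
From mathcomp Require Import reals.

Set Implicit Arguments.
Unset Strict Implicit.
Unset Printing Implicit Defensive.

Import GRing.Theory Num.Theory.
Local Open Scope ring_scope.

(* Labels a, b, c of edges of a tetrahedron (and of corners of triangles), and
   labels ab, bc, ca of sides of triangles (and of short sides of hexagons). *)

Inductive elabel := La | Lb | Lc.
Inductive slabel := Sab | Sbc | Sca.

Definition ord_of_elabel (x : elabel) : 'I_3 :=
  match x with La => @Ordinal 3 0 isT | Lb => @Ordinal 3 1 isT | Lc => @Ordinal 3 2 isT end.
Definition elabel_of_ord (i : 'I_3) : elabel :=
  match val i with 0%N => La | 1%N => Lb | _ => Lc end.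
Lemma ord_of_elabelK : cancel ord_of_elabel elabel_of_ord.
Proof. by case. Qed.
HB.instance Definition _ := Finite.copy elabel (can_type ord_of_elabelK).

Definition ord_of_slabel (k : slabel) : 'I_3 :=
  match k with Sab => @Ordinal 3 0 isT | Sbc => @Ordinal 3 1 isT | Sca => @Ordinal 3 2 isT end.
Definition slabel_of_ord (i : 'I_3) : slabel :=
  match val i with 0%N => Sab | 1%N => Sbc | _ => Sca end.
Lemma ord_of_slabelK : cancel ord_of_slabel slabel_of_ord.
Proof. by case. Qed.
HB.instance Definition _ := Finite.copy slabel (can_type ord_of_slabelK).

Definition epsE (x y : elabel) : int :=
  match x, y with
  | La, Lb | Lb, Lc | Lc, La => 1
  | Lb, La | Lc, Lb | La, Lc => -1
  | _, _ => 0
  end.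

Definition epsS (k l : slabel) : int :=
  match k, l with
  | Sab, Sbc | Sbc, Sca | Sca, Sab => 1
  | Sbc, Sab | Sca, Sbc | Sab, Sca => -1
  | _, _ => 0
  end.

(* The vertices of each oriented tetrahedron are numbered 0, 1, 2, 3 so that
   1, 2, 3 appear in anticlockwise order when viewed from outside at vertex 0;
   more generally p, q, r are in anticlockwise order viewed from outside at v
   iff (v, p, q, r) is an even permutation of (0, 1, 2, 3).  The face opposite
   vertex f, and the hexagon in it, are also indexed by f. *)

(* Any labelling of the edges such that opposite edges have the same label and
   the edges at each vertex are a, b, c in anticlockwise order viewed from
   outside has this form for a suitable numbering of the vertices as above.
   The value for u = v is irrelevant. *)
Definition edge_label (u v : 'I_4) : elabel :=
  match val u, val v with
  | 0%N, 1%N | 1%N, 0%N | 2%N, 3%N | 3%N, 2%N => La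
  | 0%N, 2%N | 2%N, 0%N | 1%N, 3%N | 3%N, 1%N => Lb
  | _, _ => Lc
  end.

Definition side_between (x y : elabel) : slabel :=
  match x, y with
  | La, Lb | Lb, La => Sab
  | Lb, Lc | Lc, Lb => Sbc
  | _, _ => Sca
  end.

Definition opposite_side (x : elabel) : slabel :=
  match x with La => Sbc | Lb => Sca | Lc => Sab end.

(* For v != f, the label of the segment in which the triangle at vertex v meets
   the face opposite f: it joins the two corners of the triangle other than the
   one on the edge vf. *)
Definition side_label (v f : 'I_4) : slabel := opposite_side (edge_label v f).

Lemma epsE_edge_label_tperm (x y p q r : 'I_4) :
  x != y -> uniq [:: p; q; r] ->
  let t := tperm x y in
  epsE (edge_label (t p) (t q)) (edge_label (t p) (t r)) =
  - epsE (edge_label p q) (edge_label p r).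
Proof.
move=> xy pqr t; rewrite /t !permE /= {t}; move: x y p q r xy pqr.
by do 5![case=> [[|[|[|[|//]]]] ?] //].
Qed.

Lemma epsE_edge_label_perm (s : 'S_4) (p q r : 'I_4) : uniq [:: p; q; r] ->
  epsE (edge_label (s p) (s q)) (edge_label (s p) (s r)) =
  (-1) ^+ s * epsE (edge_label p q) (edge_label p r).
Proof.
have [ts -> dts] := prod_tpermP s; rewrite odd_perm_prod //.
elim: ts dts p q r => [_ p q r _|t ts IH /= /andP[dt dts] p q r pqr].
  by rewrite big_nil !perm1 expr0 mul1r.
rewrite big_cons !permM IH //; last first.
  by have /= -> := map_inj_uniq (@perm_inj _ (tperm t.1 t.2)) [:: p; q; r].
rewrite epsE_edge_label_tperm //.
by case: (odd _); rewrite /= ?expr0 ?expr1 ?mul1r ?mulN1r ?opprK.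
Qed.

Lemma edge_label_anticlockwise (s : 'S_4) : ~~ odd_perm s ->
  let x i := edge_label (s (inord 0)) (s (inord i)) in
  (x 1%N, x 2%N, x 3%N) \in [:: (La, Lb, Lc); (Lb, Lc, La); (Lc, La, Lb)].
Proof.
move=> /negbTE s0; set x := fun i : nat => edge_label _ _; rewrite /=.
have E i j : uniq [:: inord 0; inord i; inord j : 'I_4] ->
    epsE (x i) (x j) = epsE (edge_label (inord 0) (inord i))
                            (edge_label (inord 0) (inord j)).
  by move=> u; rewrite /x epsE_edge_label_perm // s0 expr0 mul1r.
have I i : (i < 4)%N -> val (inord i : 'I_4) = i by move=> ?; rewrite /= inordK.
have := E 1%N 2%N; have := E 2%N 3%N.
rewrite /= !inE -!(inj_eq val_inj) /edge_label !I // => /(_ isT) + /(_ isT).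
by case: (x 1%N) (x 2%N) (x 3%N) => [] [] [].
Qed.

Lemma side_labelE (v f p q : 'I_4) : uniq [:: v; f; p; q] ->
  side_label v f = side_between (edge_label v p) (edge_label v q).
Proof.
by case: v f p q => [[|[|[|[|//]]]] ?] [[|[|[|[|//]]]] ?]
  [[|[|[|[|//]]]] ?] [[|[|[|[|//]]]] ?].
Qed.

(* An oriented ideal triangulation, as gluing data for the 4n faces of n
   oriented tetrahedra.  The face F = (i, f) of t_i opposite vertex f is glued
   to a face of t_(nbr F); the gluing map is recorded by its action on the
   three vertices of F, extended to all four vertices by sending f to the
   vertex opposite the image face.  Since all tetrahedra are oriented, the
   gluing map reverses orientation iff this permutation is odd. *)
Record triangulation (n : nat) := Triangulation {
  nbr : 'I_n * 'I_4 -> 'I_n;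
  gluing : 'I_n * 'I_4 -> 'S_4;
  glued (F : 'I_n * 'I_4) : 'I_n * 'I_4 := (nbr F, gluing F F.2);
  gluing_odd : forall F, odd_perm (gluing F);
  glued_neq : forall F, glued F != F;
  nbr_glued : forall F, nbr (glued F) = F.1;
  gluing_glued : forall F, gluing (glued F) = (gluing F)^-1%g
}.

(* The vertex of the face opposite f at which its short side k lies. *)
Definition short_side_vertex (f : 'I_4) (k : slabel) : 'I_4 :=
  odflt f [pick v | (v != f) && (side_label v f == k)].

Definition hat (n : nat) (T : triangulation n) (F : 'I_n * 'I_4) (k : slabel)
  : slabel :=
  side_label (gluing T F (short_side_vertex F.2 k)) (gluing T F F.2).

Lemma side_label_inj (f u v : 'I_4) : u != f -> v != f ->
  side_label u f = side_label v f -> u = v.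
Proof.
case: f u v => [[|[|[|[|//]]]] ?] [[|[|[|[|//]]]] ?] [[|[|[|[|//]]]] ?] //;
  by move=> _ _ // _; apply: val_inj.
Qed.

Lemma short_side_vertexP (f : 'I_4) (k : slabel) :
  short_side_vertex f k != f /\ side_label (short_side_vertex f k) f = k.
Proof.
rewrite /short_side_vertex; case: pickP => [v /andP[vf /eqP] // | none].
suff [v /andP[vf /eqP kv]] : exists v : 'I_4, (v != f) && (side_label v f == k).
  by move: (none v); rewrite vf kv eqxx.
case: f k {none} => [[|[|[|[|//]]]] lt4] [];
  solve [by exists (@Ordinal 4 0 isT) | by exists (@Ordinal 4 1 isT)
       | by exists (@Ordinal 4 2 isT) | by exists (@Ordinal 4 3 isT)].
Qed.

Lemma hat_neq (n : nat) (T : triangulation n) (F : 'I_n * 'I_4) (k l : slabel) :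
  k != l -> hat T F k != hat T F l.
Proof.
apply: contra_neq.
have [kf kE] := short_side_vertexP F.2 k.
have [lf lE] := short_side_vertexP F.2 l.
move=> /side_label_inj H; rewrite -kE -lE; congr (side_label _ _).
by apply: (@perm_inj _ (gluing T F)); apply: H; rewrite (inj_eq perm_inj).
Qed.

Lemma hat_reverses (n : nat) (T : triangulation n) (F : 'I_n * 'I_4)
    (k l : slabel) : epsS (hat T F k) (hat T F l) = - epsS k l.
Proof.
have [->|kl] := eqVneq k l; first by case: (hat T F l); case: l.
have [kf kE] := short_side_vertexP F.2 k.
have [lf lE] := short_side_vertexP F.2 l.
have epsSE u v f : epsS (side_label u f) (side_label v f) =
    epsE (edge_label f u) (edge_label f v).
  rewrite /side_label; have C w : edge_label w f = edge_label f w.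
    by case: w f => [[|[|[|[|//]]]] ?] [[|[|[|[|//]]]] ?].
  by rewrite !C; case: edge_label; case: edge_label.
rewrite -{2}kE -{2}lE /hat !epsSE epsE_edge_label_perm ?gluing_odd ?mulN1r //.
rewrite /= !inE negb_or !(eq_sym F.2) kf lf /= andbT.
by apply: contra_neq kl => uv; rewrite -kE -lE uv.
Qed.

(* Triangles and hexagons are both indexed by 'I_n * 'I_4: (i, v) is the
   triangle of t_i at vertex v, (i, f) the hexagon opposite vertex f.
   Corner, Cross, Short and Long are the branches gamma_Delta(x),
   gamma_Delta(k), gamma_F(k) and gamma_F(k,l). *)
Inductive branch (n : nat) :=
| Corner of 'I_n * 'I_4 & elabel
| Cross of 'I_n * 'I_4 & slabel
| Short of 'I_n * 'I_4 & slabel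
| Long (F : 'I_n * 'I_4) (k l : slabel) of k != l.

Definition branch_codes (n : nat) : Type :=
  ('I_n * 'I_4) * (elabel + slabel + slabel
    + {kl : slabel * slabel | kl.1 != kl.2}).
Definition branch_code (n : nat) (g : branch n) : branch_codes n :=
  match g with
  | Corner D x => (D, inl (inl (inl x)))
  | Cross D k => (D, inl (inl (inr k)))
  | Short F k => (F, inl (inr k))
  | Long F k l kl => (F, inr (exist _ (k, l) kl))
  end.
Definition branch_decode (n : nat) (u : branch_codes n) : branch n :=
  match u with
  | (D, inl (inl (inl x))) => Corner D x
  | (D, inl (inl (inr k))) => Cross D k
  | (F, inl (inr k)) => Short F k
  | (F, inr (exist kl H)) => @Long n F kl.1 kl.2 H
  end.
Lemma branch_codeK (n : nat) : cancel (@branch_code n) (@branch_decode n).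
Proof. by case. Qed.
HB.instance Definition _ (n : nat) :=
  Finite.copy (branch n) (can_type (@branch_codeK n)).

Record oscillating (n : nat) (T : triangulation n) (z : branch n -> int)
  : Prop := Oscillating {
  osc_triangle : forall D,
    [/\ z (Cross D Sab) = z (Corner D La) - z (Corner D Lb),
        z (Cross D Sbc) = z (Corner D Lb) - z (Corner D Lc)
      & z (Cross D Sca) = z (Corner D Lc) - z (Corner D La)];
  osc_side : forall (i : 'I_n) (v f : 'I_4) (k l m : slabel)
      (kl : k != l) (km : k != m),
    v != f -> k = side_label v f -> l != m ->
    z (Cross (i, v) k) =
      z (Short (i, f) k) + z (Long (i, f) kl) + z (Long (i, f) km);
  osc_short : forall F k,
    z (Short F k) + z (Short (glued T F) (hat T F k)) = 0;
  osc_long : forall F (k l : slabel) (kl : k != l) (lk : l != k),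
    z (Long F kl) + z (Long (glued T F) (hat_neq T F kl)) =
    z (Long F lk) + z (Long (glued T F) (hat_neq T F lk))
}.

Definition branch_pairing (n : nat) (g g' : branch n) : int :=
  match g, g' with
  | Corner D x, Corner D' y => if D == D' then epsE x y else 0
  | Short F k, Long F' k' l _ =>
      if (F == F') && (k == k') then epsS k l else 0
  | Long F k l _, Short F' k' =>
      if (F == F') && (k == k') then - epsS k l else 0
  | Long F k l _, Long F' k' l' _ =>
      if F != F' then 0
      else if k == k' then - epsS l l'
      else if (k == l') && (l == k') then epsS k l
      else 0
  | _, _ => 0
  end.

Lemma branch_pairing_antisym (n : nat) (g g' : branch n) :
  branch_pairing g' g = - branch_pairing g g'.
Proof.
have epsEC x y : epsE y x = - epsE x y by case: x y => [] [].
have epsSC k l : epsS l k = - epsS k l by case: k l => [] [].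
case: g g' => [D x|D k|F k|F k l kl] [D' x'|D' k'|F' k'|F' k' l' kl'] //=;
  rewrite ?oppr0 //.
- by rewrite eq_sym epsEC; case: ifP; rewrite ?oppr0.
- by rewrite eq_sym (eq_sym k'); case: ifP => [/andP[_ /eqP->]|]; rewrite ?oppr0.
- rewrite eq_sym (eq_sym k'); case: ifP => [/andP[_ /eqP->]|];
    by rewrite ?opprK ?oppr0.
rewrite eq_sym; case: ifP => _; rewrite ?oppr0 // (eq_sym k').
case: ifP => _; first by rewrite epsSC.
rewrite (eq_sym k') (eq_sym l') andbC.
by case: ifP => [/andP[/eqP-> /eqP->]|_] //; rewrite oppr0.
Qed.

Definition pairing (n : nat) (z z' : branch n -> int) : int :=
  \sum_(g : branch n) \sum_(g' : branch n) z g * z' g' * branch_pairing g g'.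

Definition intersection_number (R : realType) (n : nat)
  (z z' : branch n -> int) : R := (pairing z z')%:~R / 2.

(* The 2n-dimensional space generated by a_i, b_i, c_i with a_i + b_i + c_i = 0,
   in coordinates with respect to the basis (a_i, b_i); NZgen_presentation
   below is its universal property. *)
Definition NZspace (R : realType) (n : nat) := 'M[R]_(n, 2).

Definition NZgen (R : realType) (n : nat) (i : 'I_n) (x : elabel)
  : NZspace R n :=
  match x with
  | La => delta_mx i 0
  | Lb => delta_mx i 1
  | Lc => - delta_mx i 0 - delta_mx i 1
  end.

Definition omega (R : realType) (n : nat) (u v : NZspace R n) : R :=
  \sum_(i < n) (u i 0 * v i 1 - u i 1 * v i 0).

Lemma NZgen_sum (R : realType) (n : nat) (i : 'I_n) :
  NZgen R i La + NZgen R i Lb + NZgen R i Lc = 0.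
Proof. by rewrite /= -opprD subrr. Qed.

Lemma NZgen_presentation (R : realType) (n : nat) (W : lmodType R)
    (w : 'I_n -> elabel -> W) :
  (forall i, w i La + w i Lb + w i Lc = 0) ->
  exists2 f : {linear 'M[R]_(n, 2) -> W},
    forall i x, f (NZgen R i x) = w i x
  & forall f' : {linear 'M[R]_(n, 2) -> W},
      (forall i x, f' (NZgen R i x) = w i x) -> f' =1 f.
Proof.
move=> w0; pose f (u : 'M[R]_(n, 2)) : W :=
  \sum_(i < n) (u i 0 *: w i La + u i 1 *: w i Lb).
have fL : linear f.
  move=> a u v; rewrite /f scaler_sumr -big_split; apply: eq_bigr => i _ /=.
  by rewrite !mxE scalerDr !scalerDl !scalerA addrACA.
pose fM := GRing.isLinear.Build R _ _ _ f fL.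
pose F : {linear 'M[R]_(n, 2) -> W} := HB.pack f fM.
have Fa i : F (NZgen R i La) = w i La.
  rewrite /= /f (bigD1 i) //= big1 => [|j ji]; rewrite !mxE ?eqxx ?(negbTE ji) /=.
    by rewrite scale1r scale0r !addr0.
  by rewrite !scale0r addr0.
have Fb i : F (NZgen R i Lb) = w i Lb.
  rewrite /= /f (bigD1 i) //= big1 => [|j ji]; rewrite !mxE ?eqxx ?(negbTE ji) /=.
    by rewrite scale1r scale0r add0r addr0.
  by rewrite !scale0r addr0.
have wc i : w i Lc = - w i La - w i Lb.
  by apply/eqP; rewrite -opprD -addr_eq0 addrC w0.
exists F => [i [] //|f' f'E u]; first by rewrite wc -Fa -Fb -raddfN -raddfB.
rewrite {1}[u]matrix_sum_delta linear_sum; apply: eq_bigr => i _.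
rewrite big_ord_recl big_ord1 linearD !linearZ /=.
have -> : lift ord0 ord0 = 1 :> 'I_2 by apply: val_inj.
by rewrite (f'E i La) (f'E i Lb).
Qed.

Lemma omega_gen (R : realType) (n : nat) (i j : 'I_n) (x y : elabel) :
  omega (NZgen R i x) (NZgen R j y) = (epsE x y)%:~R * (i == j)%:R.
Proof.
rewrite /omega (bigD1 i) //= big1 => [|k /negbTE ki].
  rewrite addr0; case: x y => [] [] /=; rewrite !mxE !eqxx /=; case: (i == j);
    by rewrite /= ?(mulr0, mul0r, mulr1, mul1r, subr0, sub0r, oppr0, mulN1r,
                    mulrN1, opprK, addr0, add0r, subrr, mulr0z).
case: x y => [] [] /=; rewrite !mxE !ki /=;
  by rewrite ?(mulr0, mul0r, mulr1, mul1r, subr0, sub0r, oppr0, addr0, subrr).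
Qed.

Definition branch_holonomy (R : realType) (n : nat) (g : branch n)
  : NZspace R n :=
  match g with Corner D x => NZgen R D.1 x | _ => 0 end.

Definition holonomy (R : realType) (n : nat) (z : branch n -> int)
  : NZspace R n := \sum_(g : branch n) (z g)%:~R *: branch_holonomy R g.

(* Main.v *)
(** Both sides are sums over tetrahedra.  On a triangle, the pairing of corner
    coefficients depends only on the coefficients of its sides, so expanding
    [omega (h zeta) (h zeta')] over pairs of triangles of a tetrahedron, the
    diagonal terms are the triangle part of the intersection pairing.  Two
    distinct triangles [v], [w] are joined by the edge [vw], and their cross
    term splits as one term in each of the two hexagons along this edge.  Hence
    the off-diagonal terms regroup as
    [\sum_(k, l) epsS k l * N F k * N' F l] over the hexagons [F], where [N F k]
    is the flow across the short side [k].  This differs from the hexagon part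
    of the intersection pairing by a defect which changes sign under the gluing
    [F |-> glued F], because gluing reverses [epsS]. *)
Require Import Defs.
From HB Require Import structures.
From mathcomp Require Import all_boot all_order all_algebra all_fingroup.
From mathcomp Require Import reals ring.

Set Implicit Arguments.
Unset Strict Implicit.
Unset Printing Implicit Defensive.

Import GRing.Theory Num.Theory.
Local Open Scope ring_scope.

Local Notation o0 := (@Ordinal 4 0 isT).
Local Notation o1 := (@Ordinal 4 1 isT).
Local Notation o2 := (@Ordinal 4 2 isT).
Local Notation o3 := (@Ordinal 4 3 isT).

Lemma sum_ord4 (V : nmodType) (f : 'I_4 -> V) :
  \sum_v f v = f o0 + f o1 + f o2 + f o3.
Proof.
rewrite !big_ord_recr big_ord0 /= add0r.
by do !congr (_ + _); congr f; apply: val_inj.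
Qed.

Section Branches.
Variable n : nat.
Implicit Types (D F : 'I_n * 'I_4) (z : branch n -> int).

Lemma sum_cells (V : nmodType) (f : 'I_n * 'I_4 -> V) :
  \sum_D f D = \sum_i \sum_v f (i, v).
Proof. by rewrite pair_bigA; apply: eq_bigr => -[]. Qed.

(** The index [(i, v)] names both the triangle at [v] and the hexagon opposite [v]; merging them is
    harmless, as their branches pair to zero. *)
Definition branch_cell (g : branch n) : 'I_n * 'I_4 :=
  match g with Corner D _ | Cross D _ | Short D _ | @Long _ D _ _ _ => D end.

Definition cell_branches D : seq (branch n) :=
  [:: Corner D La; Corner D Lb; Corner D Lc;
      Cross D Sab; Cross D Sbc; Cross D Sca;
      Short D Sab; Short D Sbc; Short D Sca;
      @Long n D Sab Sbc isT; @Long n D Sab Sca isT; @Long n D Sbc Sab isT;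
      @Long n D Sbc Sca isT; @Long n D Sca Sab isT; @Long n D Sca Sbc isT].

Lemma cell_branches_uniq D : uniq (cell_branches D).
Proof.
(* Without the cell, the codes form a closed list on which [uniq] computes. *)
by apply: (@map_uniq _ _ (fun g => (branch_code g).2)).
Qed.

Lemma mem_cell_branches D g : (g \in cell_branches D) = (branch_cell g == D).
Proof.
apply/idP/eqP => [|<-].
  by rewrite !inE; do ?[case/orP=> [/eqP->//|]]; move/eqP->.
case: g => [E x|E k|E k|E k l kl] /=; first by case: x; rewrite !inE eqxx ?orbT.
- by case: k; rewrite !inE eqxx ?orbT.
- by case: k; rewrite !inE eqxx ?orbT.
by case: k l kl => [] [] // kl; rewrite (bool_irrelevance kl isT) !inE eqxx ?orbT.
Qed.

Lemma sum_branches (V : nmodType) (f : branch n -> V) :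
  \sum_g f g = \sum_D \sum_(g <- cell_branches D) f g.
Proof.
rewrite (partition_big branch_cell predT) //=; apply: eq_bigr => D _.
rewrite big_uniq ?cell_branches_uniq //=.
by apply: eq_bigl => g; rewrite mem_cell_branches.
Qed.

(** Extension by 0 to [k = l] removes the dependence on a proof of [k != l], so that labels can be
    rewritten along [hat]. *)
Definition longc z F (k l : slabel) : int :=
  if @idP (k != l) is ReflectT kl then z (Long F kl) else 0.

Lemma longcE z F k l (kl : k != l) : z (Long F kl) = longc z F k l.
Proof.
rewrite /longc; case: {-}_ / idP => [h|/(_ kl) //].
by rewrite (bool_irrelevance kl h).
Qed.

(** Two triangles are allowed because [omega] also pairs corners of distinct triangles of one
    tetrahedron. *)
Definition corner_pairing z z' D D' : int :=
  z (Corner D La) * z' (Corner D' Lb) - z (Corner D Lb) * z' (Corner D' La)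
  + (z (Corner D Lb) * z' (Corner D' Lc) - z (Corner D Lc) * z' (Corner D' Lb))
  + (z (Corner D Lc) * z' (Corner D' La) - z (Corner D La) * z' (Corner D' Lc)).

Definition hexagon_pairing z z' F : int :=
  let s k := z (Short F k) in let s' k := z' (Short F k) in
  let t := longc z F in let t' := longc z' F in
  let side k l m :=
    s k * t' k l - t k l * s' k - (s k * t' k m - t k m * s' k)
    - (t k l * t' k m - t k m * t' k l) in
  let edge k l := t k l * t' l k - t l k * t' k l in
  side Sab Sbc Sca + side Sbc Sca Sab + side Sca Sab Sbc
  + edge Sab Sbc + edge Sbc Sca + edge Sca Sab.

Lemma branch_pairing_cell (g g' : branch n) :
  branch_cell g != branch_cell g' -> branch_pairing g g' = 0.
Proof.
by case: g g' => [D x|D k|F k|F k l kl]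
  [D' x'|D' k'|F' k'|F' k' l' kl'] //= /negbTE ->.
Qed.

Lemma pairing_cells z z' :
  pairing z z' = \sum_D (corner_pairing z z' D D + hexagon_pairing z z' D).
Proof.
rewrite /pairing sum_branches; apply: eq_bigr => D _.
transitivity (\sum_(g <- cell_branches D) \sum_(g' <- cell_branches D)
    z g * z' g' * branch_pairing g g').
  apply: eq_big_seq => g; rewrite mem_cell_branches => /eqP gD.
  rewrite sum_branches (bigD1 D) //= [X in _ + X]big1 ?addr0 // => D' D'D.
  rewrite big_seq big1 // => g'; rewrite mem_cell_branches => /eqP g'D.
  by rewrite branch_pairing_cell ?mulr0 // gD g'D eq_sym.
rewrite /corner_pairing /hexagon_pairing unlock /= !eqxx /= !longcE.
ring.
Qed.

Definition flow z F (k : slabel) : int :=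
  z (Short F k) + \sum_(l | l != k) longc z F k l.

Lemma sum_slabel (V : nmodType) (P : pred slabel) (f : slabel -> V) :
  \sum_(k | P k) f k =
    (if P Sab then f Sab else 0) + (if P Sbc then f Sbc else 0)
      + (if P Sca then f Sca else 0).
Proof.
have u : uniq [:: Sab; Sbc; Sca] by [].
rewrite big_mkcond.
rewrite -(eq_bigl _ _ (_ : mem [:: Sab; Sbc; Sca] =1 predT)); last by case.
by rewrite -big_uniq //= !big_cons big_nil addr0 addrA.
Qed.

Definition flow_pairing z z' F : int :=
  \sum_k \sum_l epsS k l * flow z F k * flow z' F l.

Section Gluing.
Variable T : triangulation n.

Lemma gluedK : involutive (glued T).
Proof.
by move=> F; rewrite {1}/glued gluing_glued nbr_glued /= permK -surjective_pairing.
Qed.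

Lemma cross_flow z (Hz : oscillating T z) i (v f : 'I_4) : v != f ->
  z (Cross (i, v) (side_label v f)) = flow z (i, f) (side_label v f).
Proof.
move=> vf; rewrite /flow sum_slabel.
have := osc_side Hz i _ _ vf erefl.
case: (side_label v f) => /= H.
- by rewrite (H Sbc Sca isT isT isT) !longcE; ring.
- by rewrite (H Sab Sca isT isT isT) !longcE; ring.
- by rewrite (H Sab Sbc isT isT isT) !longcE; ring.
Qed.

Lemma osc_longc z (Hz : oscillating T z) F (k l : slabel) : k != l ->
  longc z (glued T F) (hat T F k) (hat T F l) =
  longc z F l k + longc z (glued T F) (hat T F l) (hat T F k) - longc z F k l.
Proof.
move=> kl; have lk : l != k by rewrite eq_sym.
by have := osc_long Hz F kl lk; rewrite !longcE => <-; ring.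
Qed.

Lemma osc_shortN z (Hz : oscillating T z) F k :
  z (Short (glued T F) (hat T F k)) = - z (Short F k).
Proof. by apply/eqP; rewrite -addr_eq0 addrC (osc_short Hz). Qed.

Lemma hat_cases F :
  (hat T F Sab, hat T F Sbc, hat T F Sca) \in
    [:: (Sab, Sca, Sbc); (Sca, Sbc, Sab); (Sbc, Sab, Sca)].
Proof.
have := hat_reverses T F Sab Sbc; have := hat_reverses T F Sbc Sca.
by case: (hat T F Sab) (hat T F Sbc) (hat T F Sca) => [] [] [].
Qed.

(** The difference of [flow_pairing] and [hexagon_pairing] is linear in [epsS] and depends
    bilinearly on the coefficients of [z] and [z'], only through [z (Short F k)] and
    [longc z F k l - longc z F l k]. Gluing negates these quantities and also [epsS], hence the
    difference. *)
Lemma glued_defect z z' (Hz : oscillating T z) (Hz' : oscillating T z') F :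
  hexagon_pairing z z' F + hexagon_pairing z z' (glued T F) =
  flow_pairing z z' F + flow_pairing z z' (glued T F).
Proof.
have E w (Hw : oscillating T w) :=
  (osc_shortN Hw F Sab, osc_shortN Hw F Sbc, osc_shortN Hw F Sca,
   @osc_longc w Hw F Sab Sbc isT, @osc_longc w Hw F Sbc Sca isT,
   @osc_longc w Hw F Sca Sab isT).
move: (E z Hz) (E z' Hz'); rewrite /flow_pairing /flow !sum_slabel /=.
have := hat_cases F; rewrite !inE => /or3P[] /eqP[-> -> ->] e e';
  rewrite /hexagon_pairing !e !e'; ring.
Qed.

Lemma sum_hexagon_pairing z z' (Hz : oscillating T z) (Hz' : oscillating T z') :
  \sum_F hexagon_pairing z z' F = \sum_F flow_pairing z z' F.
Proof.
have dbl (f : 'I_n * 'I_4 -> int) :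
    (\sum_F f F) *+ 2 = \sum_F (f F + f (glued T F)).
  rewrite big_split mulr2n; congr (_ + _).
  exact: reindex_inj (inv_inj gluedK).
(* Doubling both sums avoids choosing one hexagon from each glued pair. *)
apply: (@pmulrnI _ 2) => //=; rewrite !dbl; apply: eq_bigr => F _.
exact: glued_defect.
Qed.

(** Adding a constant to the three corners of a triangle does not change [corner_pairing]. For
    [v != w], the corners on the edge [vw] may thus be taken as 0, leaving two products of side
    coefficients, one in each face containing [vw]. *)
Lemma tetrahedron_pairing z z' (Hz : oscillating T z) (Hz' : oscillating T z') i :
  \sum_v \sum_w corner_pairing z z' (i, v) (i, w) =
  \sum_v (corner_pairing z z' (i, v) (i, v) + flow_pairing z z' (i, v)).
Proof.
(* These twelve incidences exhaust the short sides of the four hexagons. *)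
have fl w (Hw : oscillating T w) := (
  cross_flow Hw i (isT : o0 != o1), cross_flow Hw i (isT : o0 != o2),
  cross_flow Hw i (isT : o0 != o3), cross_flow Hw i (isT : o1 != o0),
  cross_flow Hw i (isT : o1 != o2), cross_flow Hw i (isT : o1 != o3),
  cross_flow Hw i (isT : o2 != o0), cross_flow Hw i (isT : o2 != o1),
  cross_flow Hw i (isT : o2 != o3), cross_flow Hw i (isT : o3 != o0),
  cross_flow Hw i (isT : o3 != o1), cross_flow Hw i (isT : o3 != o2)).
have cr w (Hw : oscillating T w) D k : w (Cross D k) = match k with
    | Sab => w (Corner D La) - w (Corner D Lb)
    | Sbc => w (Corner D Lb) - w (Corner D Lc)
    | Sca => w (Corner D Lc) - w (Corner D La) end.
  by have [? ? ?] := osc_triangle Hw D; case: k.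
move: (fl z Hz) (fl z' Hz'); rewrite !(cr z Hz) !(cr z' Hz') /= => e e'.
rewrite !sum_ord4 /flow_pairing !sum_slabel /= -!e -!e' /corner_pairing.
ring.
Qed.

End Gluing.

(** The [Lc] corners enter both coordinates with a minus sign because [c = - a - b]. *)
Lemma holonomyE (R : realType) z i (j : 'I_2) : holonomy R z i j =
  (\sum_v (z (Corner (i, v) (if j == 0 then La else Lb))
             - z (Corner (i, v) Lc)))%:~R.
Proof.
rewrite /holonomy summxE sum_branches sum_cells.
rewrite (bigD1 i) //= [X in _ + X]big1 ?addr0 => [|i' /negbTE i'i]; last first.
  rewrite big1 // => v _; rewrite unlock /= !mxE ![i == _]eq_sym i'i /=.
  by rewrite ?(mulr0, oppr0, addr0).
rewrite rmorph_sum; apply: eq_bigr => v _; rewrite unlock /= !mxE eqxx /=.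
case: j => [[|[|//]] lt2] /=; rewrite -?val_eqE /= rmorphB /=; ring.
Qed.

Lemma omega_holonomy (R : realType) z z' :
  omega (holonomy R z) (holonomy R z') =
  (\sum_i \sum_v \sum_w corner_pairing z z' (i, v) (i, w))%:~R.
Proof.
rewrite /omega rmorph_sum; apply: eq_bigr => i _; rewrite !holonomyE /=.
rewrite -!rmorphM -rmorphB /=; congr _%:~R.
(* [(A - C)(B' - C') - (B - C)(A' - C')] expands to the cyclic form of [corner_pairing], as the
   [C C'] terms cancel. *)
by rewrite !sum_ord4 /corner_pairing; ring.
Qed.

End Branches.

Theorem theorem5p3 (R : realType) (n : nat) (n_gt0 : (0 < n)%N)
    (T : triangulation n) (zeta zeta' : branch n -> int)
    (Hzeta : oscillating T zeta) (Hzeta' : oscillating T zeta') :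
  omega (holonomy R zeta) (holonomy R zeta') =
    2 * intersection_number R zeta zeta'.
Proof.
rewrite /intersection_number mulrCA mulfV ?mulr1 ?pnatr_eq0 // omega_holonomy.
congr _%:~R; rewrite pairing_cells big_split /=.
rewrite (sum_hexagon_pairing Hzeta Hzeta') -big_split sum_cells /=.
by apply: eq_bigr => i _; rewrite (tetrahedron_pairing Hzeta Hzeta').
Qed.
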